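(* Let $p$ and $q$ be two nonnegative integers such that $p>q$, and put $n:=p+q$. For every nonnegative integer $k$ with $k\leq 2q+1$, let $\beta_{k,p,q}$ be the number of symmetric $(2p,2q+1)$ clans with exactly $k$ pairs. Then $$\beta_{k,p,q}=\begin{cases}\binom{n-2l}{p-l}\binom{n}{2l}a_{2l} & \text{if } k=2l;\\[4pt] \binom{n-(2l+1)}{p-(l+1)}\binom{n}{2l+1}a_{2l+1} & \text{if } k=2l+1,\end{cases}$$ where $$a_{2l}:=\sum_{b=0}^{l}\binom{2l}{2b}\frac{(2b)!}{b!}\qquad\text{and}\qquad a_{2l+1}:=\sum_{b=0}^{l}\binom{2l+1}{2b}\frac{(2b)!}{b!}.$$ In particular, the total number $b_{p,q}$ of symmetric $(2p,2q+1)$ clans is $$b_{p,q}=\sum_{l=0}^{q}\left(\binom{n-2l}{p-l}\binom{n}{2l}a_{2l}+\binom{n-(2l+1)}{p-(l+1)}\binom{n}{2l+1}a_{2l+1}\right).$$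
   Context: For integers $s>t\ge 0$, an $(s,t)$ preclan is a string $c_1c_2\cdots c_{s+t}$ of length $s+t$, whose entries are the symbols $+$, $-$ or natural numbers, such that (1) there are $s-t$ more $+$'s than $-$'s, and (2) every number that appears in the string appears exactly twice. Two $(s,t)$ preclans are equivalent if they have the same signs in the same positions and the positions of the matching (equal) numbers are the same in both (so the actual values of the numbers do not matter; for example $1221$ and $2112$ are equivalent). An $(s,t)$ clan is an equivalence class of $(s,t)$ preclans. The clan of $\gamma=c_1\cdots c_{m}$ is symmetric if $\gamma$ and its reversal $c_{m}\cdots c_1$ are equivalent. A clan has exactly $k$ pairs if exactly $k$ distinct numbers appear in a preclan representing it (equivalently, the involution of the positions $\{1,\dots,m\}$ that exchanges positions carrying equal numbers and fixes positions carrying signs has exactly $k$ 2-cycles). *)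

(* Defs.v *)
From HB Require Import structures.
From mathcomp Require Import all_boot generic_quotient.
Set Implicit Arguments.
Unset Strict Implicit.
Unset Printing Implicit Defensive.

Inductive symbol := Plus | Minus | Number of nat.

Definition symbol_code (x : symbol) : bool + nat :=
  match x with Plus => inl true | Minus => inl false | Number v => inr v end.

Definition symbol_decode (y : bool + nat) : symbol :=
  match y with inl b => if b then Plus else Minus | inr v => Number v end.

Lemma symbol_codeK : cancel symbol_code symbol_decode.
Proof. by case. Qed.

HB.instance Definition _ := Countable.copy symbol (can_type symbol_codeK).

Definition is_number (x : symbol) : bool :=
  if x is Number _ then true else false.

(* The first equation is (#Plus) - (#Minus) = s - t, without truncated
   subtraction. *)
Definition is_preclan (s t : nat) (c : (s + t).-tuple symbol) : bool :=
  (count_mem Plus c + t == count_mem Minus c + s) &&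
  all (fun x => is_number x ==> (count_mem x c == 2)) c.

Record preclan (s t : nat) := Preclan {
  preclan_string :> (s + t).-tuple symbol;
  preclanP : is_preclan preclan_string
}.

HB.instance Definition _ (s t : nat) := [isSub for @preclan_string s t].
HB.instance Definition _ (s t : nat) := [Countable of preclan s t by <:].

Definition same_sign (x y : symbol) : bool :=
  ((x == Plus) == (y == Plus)) && ((x == Minus) == (y == Minus)).

Definition matched m (c : m.-tuple symbol) (i j : 'I_m) : bool :=
  is_number (tnth c i) && (tnth c i == tnth c j).

Definition equiv_strings m (c d : m.-tuple symbol) : bool :=
  [forall i, same_sign (tnth c i) (tnth d i)] &&
  [forall i, forall j, matched c i j == matched d i j].

Lemma equiv_stringsP m (c d : m.-tuple symbol) :
  reflect ((forall i, same_sign (tnth c i) (tnth d i)) /\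
           (forall i j, matched c i j = matched d i j))
          (equiv_strings c d).
Proof.
apply: (iffP andP) => -[hs hm]; split.
- exact/forallP.
- by move=> i j; move/forallP: hm => /(_ i) /forallP /(_ j) /eqP.
- exact/forallP.
- by apply/forallP => i; apply/forallP => j; rewrite hm.
Qed.

Lemma equiv_strings_refl m : reflexive (@equiv_strings m).
Proof. by move=> c; apply/equiv_stringsP; split=> // i; rewrite /same_sign !eqxx. Qed.

Lemma equiv_strings_sym m : symmetric (@equiv_strings m).
Proof.
suff h c d : @equiv_strings m c d -> equiv_strings d c.
  by move=> c d; apply/idP/idP; exact: h.
move=> /equiv_stringsP[hs hm]; apply/equiv_stringsP; split=> // i.
by have := hs i; rewrite /same_sign eq_sym [X in _ && X]eq_sym.
Qed.

Lemma equiv_strings_trans m : transitive (@equiv_strings m).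
Proof.
move=> d c e /equiv_stringsP[hs hm] /equiv_stringsP[hs' hm'].
apply/equiv_stringsP; split=> [i|i j]; last by rewrite hm hm'.
by have := hs i; rewrite /same_sign => /andP[/eqP-> /eqP->]; exact: hs'.
Qed.

Definition preclan_equiv (s t : nat) (c d : preclan s t) : bool :=
  equiv_strings c d.

Lemma preclan_equiv_refl s t : reflexive (@preclan_equiv s t).
Proof. by move=> c; exact: equiv_strings_refl. Qed.

Lemma preclan_equiv_sym s t : symmetric (@preclan_equiv s t).
Proof. by move=> c d; exact: equiv_strings_sym. Qed.

Lemma preclan_equiv_trans s t : transitive (@preclan_equiv s t).
Proof. by move=> d c e; exact: equiv_strings_trans. Qed.

Canonical preclan_equivRel (s t : nat) :=
  EquivRel (@preclan_equiv s t) (@preclan_equiv_refl s t)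
           (@preclan_equiv_sym s t) (@preclan_equiv_trans s t).

Definition clan (s t : nat) : Type := {eq_quot (@preclan_equiv s t)}%qT.

HB.instance Definition _ (s t : nat) := EqQuotient.on (clan s t).
HB.instance Definition _ (s t : nat) := Choice.on (clan s t).

Definition clan_of (s t : nat) (c : preclan s t) : clan s t :=
  (\pi_(clan s t) c)%qT.

Lemma clan_ofP s t (c d : preclan s t) :
  reflect (clan_of c = clan_of d) (preclan_equiv c d).
Proof. by rewrite /clan_of; apply: (iffP idP) => /eqmodP. Qed.

Lemma clan_of_repr s t (g : clan s t) : clan_of (repr g) = g.
Proof. exact: reprK. Qed.

Lemma repr_clan_of s t (c : preclan s t) : preclan_equiv (repr (clan_of c)) c.
Proof. by apply/clan_ofP; rewrite clan_of_repr. Qed.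

Definition symmetric_string m (c : m.-tuple symbol) : bool :=
  equiv_strings c [tuple of rev c].

Definition npairs_string m (c : m.-tuple symbol) : nat :=
  size (undup [seq x <- c | is_number x]).

Definition symmetric_clan (s t : nat) (g : clan s t) : bool :=
  symmetric_string (repr g).

Definition npairs (s t : nat) (g : clan s t) : nat := npairs_string (repr g).

(* symmetric_clan and npairs do not depend on the chosen representative: see
   symmetric_clan_of and npairs_clan_of. *)

Lemma equiv_strings_rev m (c d : m.-tuple symbol) :
  equiv_strings c d -> equiv_strings [tuple of rev c] [tuple of rev d].
Proof.
have tnth_revt (e : m.-tuple symbol) i :
    tnth [tuple of rev e] i = tnth e (rev_ord i).
  rewrite (tnth_nth Plus) [RHS](tnth_nth Plus) /= nth_rev size_tuple //.
move=> /equiv_stringsP[hs hm]; apply/equiv_stringsP; split=> [i|i j].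
  by rewrite !tnth_revt.
by have := hm (rev_ord i) (rev_ord j); rewrite /matched !tnth_revt.
Qed.

Lemma symmetric_clan_of s t (c : preclan s t) :
  symmetric_clan (clan_of c) = symmetric_string c.
Proof.
suff h (d e : (s + t).-tuple symbol) :
    equiv_strings d e -> symmetric_string d -> symmetric_string e.
  have rc := repr_clan_of c; apply/idP/idP; apply: h => //.
  by rewrite equiv_strings_sym.
move=> de dr; apply: equiv_strings_trans (equiv_strings_rev de).
by apply: equiv_strings_trans dr; rewrite equiv_strings_sym.
Qed.

Lemma count_number_preclan s t (c : preclan s t) :
  count is_number c = npairs_string c * 2.
Proof.
rewrite /npairs_string -size_filter.
have /andP[_ /allP h] := preclanP c.
set r := [seq x <- c | is_number x].
have -> : size r = \sum_(x <- undup r) count_mem x r.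
  have := perm_count_undup r => /perm_size <-.
  by rewrite size_flatten /shape -map_comp sumnE big_map;
     apply: eq_bigr => x _ /=; rewrite size_nseq.
rewrite (eq_big_seq (fun=> 2)) => [|x].
  by rewrite big_const_seq count_predT iter_addn_0 mulnC.
rewrite mem_undup mem_filter => /andP[nx xc].
rewrite count_filter -(eqP (implyP (h x xc) nx)).
by apply: eq_count => y /=; case: eqP => // ->; rewrite nx.
Qed.

Lemma npairs_clan_of s t (c : preclan s t) :
  npairs (clan_of c) = npairs_string c.
Proof.
apply/eqP; rewrite -(eqn_pmul2r (isT : 0 < 2)) -!count_number_preclan.
rewrite -!sum1_count !(big_tuple _ _ _ is_number).
apply/eqP; apply: eq_bigl => i.
have /equiv_stringsP[_ /(_ i i)] := repr_clan_of c.
by rewrite /matched !eqxx !andbT.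
Qed.

(* There are finitely many clans: relabelling every number by the position of
   its first occurrence gives an equivalent preclan over a finite alphabet. *)

Definition relabel (c : seq symbol) (x : symbol) : symbol :=
  if is_number x then Number (index x c) else x.

Lemma relabel_inj (c : seq symbol) : {in c &, injective (relabel c)}.
Proof.
move=> x y xc yc; rewrite /relabel.
case: x xc => [||a] xc; case: y yc => [||b] yc //= [e].
by rewrite -(nth_index Plus xc) e nth_index.
Qed.

Lemma relabel_sign (c : seq symbol) x :
  (relabel c x == Plus) = (x == Plus) /\ (relabel c x == Minus) = (x == Minus).
Proof. by case: x. Qed.

Lemma is_number_relabel (c : seq symbol) x :
  is_number (relabel c x) = is_number x.
Proof. by case: x. Qed.

Lemma relabel_is_preclan s t (c : preclan s t) :
  is_preclan [tuple of map (relabel c) c].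
Proof.
have /andP[hs /allP h] := preclanP c; apply/andP; split.
  have cP : count_mem Plus (map (relabel c) c) = count_mem Plus c.
    by rewrite count_map; apply: eq_count => x; exact: (relabel_sign c x).1.
  have cM : count_mem Minus (map (relabel c) c) = count_mem Minus c.
    by rewrite count_map; apply: eq_count => x; exact: (relabel_sign c x).2.
  by rewrite [X in count_mem Plus X]/= [X in count_mem Minus X]/= cP cM.
apply/allP => _ /mapP[x xc ->]; apply/implyP; rewrite is_number_relabel => nx.
rewrite count_map -(eqP (implyP (h x xc) nx)); apply/eqP.
apply: eq_in_count => y yc /=; exact: (inj_in_eq (@relabel_inj c)).
Qed.

Lemma relabel_equiv s t (c : preclan s t) :
  preclan_equiv (Preclan (relabel_is_preclan c)) c.
Proof.
apply/equiv_stringsP; split=> [i|i j] /=; rewrite /same_sign /matched !tnth_map.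
  by have [-> ->] := relabel_sign c (tnth c i); rewrite !eqxx.
rewrite is_number_relabel (inj_in_eq (@relabel_inj c)) ?mem_tnth //.
Qed.

Definition finite_code (m : nat) (x : symbol) : bool + 'I_m.+1 :=
  match x with
  | Plus => inl true | Minus => inl false | Number v => inr (inord v)
  end.

Definition finite_decode (m : nat) (y : bool + 'I_m.+1) : symbol :=
  match y with inl b => if b then Plus else Minus | inr v => Number v end.

Definition clan_code (s t : nat) (g : clan s t) :
    (s + t).-tuple (bool + 'I_(s + t).+1) :=
  [tuple of map (finite_code (s + t)) (map (relabel (repr g)) (repr g))].

Definition clan_decode (s t : nat)
    (w : (s + t).-tuple (bool + 'I_(s + t).+1)) : option (clan s t) :=
  omap (@clan_of s t) (insub [tuple of map (@finite_decode (s + t)) w]).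

Lemma clan_codeK s t : pcancel (@clan_code s t) (@clan_decode s t).
Proof.
move=> g; rewrite /clan_decode /clan_code.
set w := [tuple of _].
have -> : w = Preclan (relabel_is_preclan (repr g)) :> (s + t).-tuple symbol.
  apply: val_inj => /=; rewrite -map_comp -[RHS]map_id.
  apply/eq_in_map => _ /mapP[x xc ->] /=.
  rewrite /relabel; case: x xc => //= v vc; rewrite inordK //.
  by rewrite ltnS (leq_trans (index_size _ _)) // size_tuple.
rewrite valK /=; congr Some.
by rewrite -[RHS]clan_of_repr; apply/clan_ofP/relabel_equiv.
Qed.

HB.instance Definition _ (s t : nat) := PCanIsCountable (@clan_codeK s t).
HB.instance Definition _ (s t : nat) : isFinite (clan s t) :=
  PCanIsFinite (@clan_codeK s t).

Definition beta (k p q : nat) : nat :=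
  #|[set g : clan (2 * p) (2 * q + 1) | symmetric_clan g & npairs g == k]|.

Definition nsymmetric_clans (p q : nat) : nat :=
  #|[set g : clan (2 * p) (2 * q + 1) | symmetric_clan g]|.

(* The quotient is exact. *)
Definition a_even (l : nat) : nat :=
  \sum_(0 <= b < l.+1) 'C(2 * l, 2 * b) * ((2 * b)`! %/ b`!).

Definition a_odd (l : nat) : nat :=
  \sum_(0 <= b < l.+1) 'C(2 * l + 1, 2 * b) * ((2 * b)`! %/ b`!).

(* Main.v *)
Require Import Defs.
From mathcomp Require Import all_boot zify generic_quotient.

(** A clan is the same thing as a pair [(f, P)]: the involution [f] of the
    positions that exchanges matched positions, and the set [P] of positions
    carrying a plus, which avoids the positions moved by [f]
    ([equiv_shape], [string_ofP]).  The clan is symmetric exactly when [f]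
    commutes with the reversal of the positions and [P] is stable under it
    ([symmetric_stringE]), and with [k] pairs the sign condition of an
    [(s, t)] clan amounts to [#|P| + k = s] ([is_preclanE]).  So the task is
    to count such pairs ([card_symmetric_clans], [card_clan_shapes]).

    The reversal of an odd number [2n + 1] of positions has one fixed point,
    the center, and [n] orbits of size two, each meeting the first half of
    the positions once.  An involution commuting with the reversal maps the
    center to a fixed point of the reversal, hence fixes it.  The set of moved
    positions is therefore a union of [k] of the [n] two-element orbits, and
    [P] is a stable subset of the rest, of prescribed size: the parity of that
    size decides whether [P] contains the center, and half of what remains is
    the number of two-element orbits, among [n - k], that [P] contains.  This
    gives both binomial coefficients ([card_stable_subsets_free],
    [card_stable_subsets]).

    The remaining factor is the number of involutions that commute with the
    reversal and move every point of a union of [k] orbits.  Look at the image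
    of one moved point [x]: it is either its mirror image, which leaves [k - 1]
    orbits, or one of [2(k - 1)] other points, in which case the mirror images
    of the two are exchanged as well and [k - 2] orbits are left.  Hence
    [u_k = u_(k-1) + 2 (k - 1) u_(k-2)] ([card_sym_invols]), a recurrence also
    satisfied by the sums in the statement, by Pascal's rule and absorption
    ([sym_pairingsS]). *)

Set Implicit Arguments.
Unset Strict Implicit.
Unset Printing Implicit Defensive.

(** * A recurrence for the numbers of pairings *)

(** The number [a_m] of the statement for either parity of [m]: the [b]-th term
    chooses [2b] of [m] mirror orbits and joins them in pairs, each pair in one
    of two ways, since [(2b)! / b! = 2^b (2b - 1)!!].  Summing up to [m] rather
    than [m/2] adds only zero terms and spares a case distinction. *)
Definition sym_pairings (m : nat) : nat :=
  \sum_(0 <= b < m.+1) 'C(m, 2 * b) * ((2 * b)`! %/ b`!).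

Lemma sym_pairings_widen m N : m < 2 * N ->
  \sum_(0 <= b < N) 'C(m, 2 * b) * ((2 * b)`! %/ b`!) = sym_pairings m.
Proof.
pose F b := 'C(m, 2 * b) * ((2 * b)`! %/ b`!).
have sumE M d : m < 2 * M -> \sum_(0 <= b < M) F b = \sum_(0 <= b < M + d) F b.
  move=> ltmM; rewrite [RHS](@big_cat_nat _ _ _ M) ?leq_addr //=.
  rewrite [X in _ + X]big_nat_cond [X in _ + X]big1 ?addn0 // => b.
  by rewrite andbT => /andP[leMb _]; rewrite /F bin_small ?mul0n //; lia.
move=> ltmN; rewrite /sym_pairings (sumE N m.+1) //.
by rewrite [RHS](sumE m.+1 N) 1?addnC //; lia.
Qed.

(** Both sides are exact quotients; writing [(2b)! / b!] as a falling factorial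
    allows cancelling [(b + 1)!]. *)
Lemma factD_succ b :
  (2 * b.+1)`! %/ b.+1`! = 2 * (b.*2.+1 * ((2 * b)`! %/ b`!)).
Proof.
have E c : (2 * c)`! %/ c`! = (2 * c) ^_ c.
  by rewrite ffact_factd ?leq_pmull //; congr (_ %/ _`!); lia.
apply/eqP; rewrite -(eqn_pmul2r (fact_gt0 b.+1)) !E.
have F c : (2 * c) ^_ c * c`! = (2 * c)`!.
  by rewrite -[RHS](@ffact_fact _ c) ?leq_pmull //; congr (_ * _`!); lia.
rewrite F (_ : 2 * b.+1 = (2 * b).+2) ?mulnS // !factS -F -mul2n.
by apply/eqP; lia.
Qed.

(** Pascal's rule splits [C(m + 2, 2b)]; in the second half, absorption turns
    [(2b + 1) C(m + 1, 2b + 1)] into [(m + 1) C(m, 2b)]. *)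
Lemma sym_pairingsS m :
  sym_pairings m.+2 = sym_pairings m.+1 + 2 * (m.+1 * sym_pairings m).
Proof.
rewrite {1}/sym_pairings -(@sym_pairings_widen m.+1 m.+3); last by lia.
rewrite -(@sym_pairings_widen m m.+2); last by lia.
rewrite !(@big_nat_recl _ _ _ m.+2) // !muln0 !bin0 -addnA; congr (_ + _).
rewrite !big_distrr -big_split /=; apply: eq_bigr => b _.
have -> : 'C(m.+2, 2 * b.+1) = 'C(m.+1, 2 * b.+1) + 'C(m.+1, (2 * b).+1).
  by rewrite mulnS binS.
rewrite mulnDl; congr (_ + _); rewrite factD_succ.
have := mul_bin_diag m.+1 (2 * b); rewrite /= => E.
set D := (_ %/ _); rewrite mulnCA [X in 2 * X]mulnA [X in 2 * (X * _)]mulnC.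
by rewrite -mul2n -E -!mulnA.
Qed.

Lemma sym_pairings0 : sym_pairings 0 = 1.
Proof. by rewrite /sym_pairings big_nat1 bin0. Qed.

Lemma sym_pairings1 : sym_pairings 1 = 1.
Proof. by rewrite -(@sym_pairings_widen 1 1) // big_nat1 bin0. Qed.

Lemma a_evenE l : a_even l = sym_pairings (2 * l).
Proof. by rewrite -(@sym_pairings_widen _ l.+1) //; lia. Qed.

Lemma a_oddE l : a_odd l = sym_pairings (2 * l + 1).
Proof. by rewrite -(@sym_pairings_widen _ l.+1) //; lia. Qed.

(** * Involutions commuting with a reflection *)

Section Symmetric.
Variables (T : finType) (r : T -> T).
Hypothesis rK : involutive r.
Implicit Types (f g t : {ffun T -> T}) (A B S U : {set T}).

Definition stable A : bool := [forall x, (r x \in A) == (x \in A)].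

Lemma stableP A : reflect (forall x, (r x \in A) = (x \in A)) (stable A).
Proof. exact: 'forall_eqP. Qed.

Lemma stableC A : stable A -> stable (~: A).
Proof. by move/stableP=> sA; apply/stableP => x; rewrite !inE sA. Qed.

Lemma stableD A B : stable A -> stable B -> stable (A :\: B).
Proof.
by move=> /stableP sA /stableP sB; apply/stableP => x; rewrite !inE sA sB.
Qed.

Definition moved f : {set T} := [set x | f x != x].

(** The set of moved points is prescribed exactly, so that the count can proceed
    by removing a union of cycles from [A]. *)
Definition sym_invols A : {set {ffun T -> T}} :=
  [set f : {ffun T -> T} |
    [&& [forall x, f (f x) == x], [forall x, f (r x) == r (f x)]
      & moved f == A]].

Lemma sym_involsP A f :
  reflect [/\ forall x, f (f x) = x, forall x, f (r x) = r (f x)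
            & forall x, (f x != x) = (x \in A)] (f \in sym_invols A).
Proof.
rewrite inE; apply: (iffP and3P) => [[/'forall_eqP ff /'forall_eqP fr /eqP fA]|].
  by split=> // x; rewrite -fA inE.
move=> [ff fr fA]; split; [exact/'forall_eqP|exact/'forall_eqP|].
by apply/eqP/setP => x; rewrite inE fA.
Qed.

Lemma sym_invols_stable A f : f \in sym_invols A -> stable A.
Proof.
case/sym_involsP => _ fr fA; apply/stableP => x.
by rewrite -!fA fr (inj_eq (inv_inj rK)).
Qed.

Lemma sym_invols_mem A f x : f \in sym_invols A -> (f x \in A) = (x \in A).
Proof. by case/sym_involsP => ff _ fA; rewrite -!fA ff eq_sym. Qed.

Lemma sym_invols_id A f x : f \in sym_invols A -> x \notin A -> f x = x.
Proof. by case/sym_involsP => _ _ fA; rewrite -fA negbK => /eqP. Qed.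

(** The smallest [r]-stable set containing [x] and [y]; it has two elements
    when [y = r x]. *)
Definition block x y : {set T} := [set x; y; r x; r y].

(** Commuting with [r] forces the exchange of [x] and [y] to be accompanied by
    that of [r x] and [r y]; for [y = r x] the two exchanges agree, so that a
    single formula covers both kinds of cycles. *)
Definition swap x y : {ffun T -> T} :=
  [ffun z => if z == x then y else if z == y then x
             else if z == r x then r y else if z == r y then r x else z].

Lemma block_stable x y : stable (block x y).
Proof.
apply/stableP => z; rewrite !inE !(inj_eq (inv_inj rK)) !(inv_eq rK).
by case: (z == x); case: (z == y); case: (z == r x); case: (z == r y).
Qed.

Lemma swap_invol x y : x != y -> r x != x -> r y != y ->
  swap x y \in sym_invols (block x y).
Proof.
move=> xy xr yr.
have rI := inv_inj rK.
have yx : y != x by rewrite eq_sym.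
apply/sym_involsP; split=> z; rewrite !ffunE.
- have [->|zx] := eqVneq z x; first by rewrite (negPf yx) eqxx.
  have [->|zy] := eqVneq z y; first by rewrite eqxx.
  have [->|zrx] := eqVneq z (r x).
    rewrite (negPf yr) (inj_eq rI) (negPf yx) eqxx.
    by case: eqVneq => // <-; rewrite rK.
  have [->|zry] := eqVneq z (r y).
    rewrite (negPf xr) eqxx.
    by case: eqVneq => // <-; rewrite rK.
  by rewrite (negPf zx) (negPf zy) (negPf zrx) (negPf zry).
- rewrite !(inj_eq rI) !(inv_eq rK).
  have [->|zx] := eqVneq z x.
    rewrite eq_sym (negPf xr).
    by case: eqVneq => // ->; rewrite ?rK.
  have [->|zy] := eqVneq z y.
    rewrite [y == r y]eq_sym (negPf yr).
    by case: eqVneq => // ->; rewrite ?rK.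
  have [_|_] := eqVneq z (r x); first by rewrite rK.
  by have [_|_] := eqVneq z (r y); first by rewrite rK.
- rewrite !inE.
  have [->|zx] := eqVneq z x; first by rewrite yx.
  have [->|zy] := eqVneq z y; first by rewrite xy.
  have [->|zrx] := eqVneq z (r x); first by rewrite (inj_eq rI) yx.
  have [->|zry] := eqVneq z (r y); first by rewrite (inj_eq rI) xy.
  by rewrite eqxx.
Qed.

Lemma sym_invols_block A x y f : f \in sym_invols A -> f x = y ->
  {in block x y, f =1 swap x y}.
Proof.
case/sym_involsP => ff fr _ fx z; rewrite ffunE !inE.
have fy : f y = x by rewrite -fx ff.
have [->|_] := eqVneq z x; first by [].
have [->|_] := eqVneq z y; first by [].
have [->|_] := eqVneq z (r x); first by rewrite fr fx.
by have [->|//] := eqVneq z (r y); first by rewrite fr fy.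
Qed.

(** As [f] and [t] agree on [B], composing with [t] cancels [f] on [B] and
    leaves it unchanged elsewhere.  This is the inverse of the gluing below:
    both are composition with the involution [t]. *)
Lemma sym_invols_cut A B f t : f \in sym_invols A -> t \in sym_invols B ->
  {in B, f =1 t} -> [ffun z => f (t z)] \in sym_invols (A :\: B).
Proof.
move=> fA tB ft.
have fE z : f (t z) = if z \in B then z else f z.
  case: ifP => zB; last by rewrite (sym_invols_id tB) ?zB.
  by rewrite ft ?(sym_invols_mem _ tB) //; case/sym_involsP: tB.
have /stableP sB := sym_invols_stable tB.
have [ff fr fA'] := sym_involsP _ _ fA; have [tt _ _] := sym_involsP _ _ tB.
have fB z : (f z \in B) = (z \in B).
  apply/idP/idP => zB; last by rewrite ft // (sym_invols_mem _ tB).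
  by rewrite -(ff z) ft // (sym_invols_mem _ tB).
apply/sym_involsP; split=> z; rewrite !ffunE !fE.
- by case zB: (z \in B); rewrite ?zB // fB zB.
- by rewrite sB; case: ifP.
- by rewrite !inE; case: ifP; rewrite ?eqxx ?fA'.
Qed.

Lemma sym_invols_glue A B g t : B \subset A ->
  g \in sym_invols (A :\: B) -> t \in sym_invols B ->
  [ffun z => g (t z)] \in sym_invols A /\
  {in B, [ffun z => g (t z)] =1 t}.
Proof.
move=> BA gA tB.
have gE z : g (t z) = if z \in B then t z else g z.
  case: ifP => zB; last by rewrite (sym_invols_id tB) ?zB.
  by rewrite (sym_invols_id gA) // inE (sym_invols_mem _ tB) zB.
have /stableP sB := sym_invols_stable tB.
have [gg gr gA'] := sym_involsP _ _ gA; have [tt tr tB'] := sym_involsP _ _ tB.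
have gB z : z \notin B -> g z \notin B.
  move=> zB; have [zA|zA] := boolP (z \in A :\: B).
    by move: zA; rewrite -(sym_invols_mem _ gA) inE => /andP[].
  by rewrite (sym_invols_id gA).
split=> [|z zB]; last by rewrite ffunE gE zB.
apply/sym_involsP; split=> z; rewrite !ffunE !gE.
- case zB: (z \in B); first by rewrite (sym_invols_mem _ tB) zB tt.
  by rewrite (negPf (gB _ _)) ?zB.
- by rewrite sB; case: ifP.
- case: ifP => zB; first by rewrite tB' zB (subsetP BA).
  by rewrite gA' inE zB.
Qed.

(** Composition with [swap x y] is an involution on functions, hence injective,
    and carries the one set to the other. *)
Lemma card_sym_invols_val A x y : stable A -> x \in A -> y \in A ->
    r x != x -> r y != y -> x != y ->
  #|[set f : {ffun T -> T} in sym_invols A | f x == y]|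
  = #|sym_invols (A :\: block x y)|.
Proof.
move=> /stableP sA xA yA xr yr xy.
have [t [tB tx ft]] : exists t : {ffun T -> T}, [/\ t \in sym_invols (block x y),
    t x = y & forall f, f \in sym_invols A -> f x = y -> {in block x y, f =1 t}].
  exists (swap x y); split; [exact: swap_invol | by rewrite ffunE eqxx|].
  by move=> f fA fx; exact: (sym_invols_block fA).
pose F g : {ffun T -> T} := [ffun z => g (t z)].
have FK : involutive F.
  by move=> g; apply/ffunP => z; rewrite !ffunE; case/sym_involsP: tB => ->.
have BA : block x y \subset A.
  apply/subsetP => z; rewrite !inE.
  by case/orP=> [/orP[/orP[]|]|] /eqP->; rewrite ?sA.
have xB : x \in block x y by rewrite !inE eqxx.
rewrite -(card_imset _ (inv_inj FK)); apply: eq_card => g.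
apply/imsetP/idP => [[f] |gA].
  rewrite inE => /andP[fA /eqP fx] ->.
  exact: (sym_invols_cut fA tB (ft f fA fx)).
have [gA' gt] := sym_invols_glue BA gA tB.
exists (F g); last by rewrite FK.
by rewrite inE gA' gt // tx eqxx.
Qed.

Lemma card_block x y : x != y -> r x != x -> r y != y ->
  #|block x y| = if y == r x then 2 else 4.
Proof.
move=> xy xr yr; rewrite /block.
case: eqVneq => [->|yrx].
  have -> : [set x; r x; r x; r (r x)] = [set x; r x].
    by apply/setP => z; rewrite !inE rK; case: (z == x); case: (z == r x).
  by rewrite cards2 eq_sym xr.
rewrite -!setUA !cardsU1 cards1 !inE.
rewrite [x == r x]eq_sym (negPf xr) (negPf xy) [y == r y]eq_sym (negPf yr).
rewrite (inj_eq (inv_inj rK)) (negPf xy) (negPf yrx).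
by rewrite -[x == r y](inj_eq (inv_inj rK)) rK eq_sym (negPf yrx).
Qed.

(** The [2k - 1] possible images of a chosen [x] are its mirror image, which uses
    up one orbit, and [2k - 2] others, each of which uses up two. *)
Lemma card_sym_invols k A : stable A -> {in A, forall x, r x != x} ->
  #|A| = 2 * k -> #|sym_invols A| = sym_pairings k.
Proof.
elim/ltn_ind: k A => -[|k] IH A sA nA cA.
  have -> : A = set0 by apply: cards0_eq; rewrite cA.
  rewrite sym_pairings0 -(cards1 [ffun z : T => z]); apply: eq_card => f.
  rewrite [RHS]inE; apply/sym_involsP/eqP => [[_ _ f0]|->].
    by apply/ffunP => z; rewrite ffunE; apply/eqP; rewrite -[_ == _]negbK f0 inE.
  by split=> z; rewrite !ffunE // eqxx inE.
have [x xA] : exists x, x \in A by apply/set0Pn; rewrite -card_gt0 cA.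
have xr := nA x xA; have rxA : r x \in A by move/stableP: sA => ->.
have cut y : y \in A -> x != y ->
    #|[set f : {ffun T -> T} in sym_invols A | f x == y]| =
    if y == r x then sym_pairings k else sym_pairings k.-1.
  move=> yA xy; have yr := nA y yA.
  have BA : block x y \subset A.
    move/stableP: sA => sA; apply/subsetP => z; rewrite !inE.
    by case/orP=> [/orP[/orP[]|]|] /eqP->; rewrite ?sA.
  rewrite card_sym_invols_val //.
  have := cardsD A (block x y); rewrite (setIidPr BA) card_block // cA => cAB.
  have := subset_leq_card BA; rewrite card_block // cA => leBA.
  have sAB := stableD sA (block_stable x y).
  have nAB : {in A :\: block x y, forall z, r z != z}.
    by move=> z /setDP[zA _]; exact: nA.
  case: ifP cAB leBA => _ cAB leBA; apply: IH => //; lia.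
have fxA f : f \in sym_invols A -> f x \in A :\ x.
  move=> fA; rewrite !inE (sym_invols_mem _ fA) xA andbT.
  by case/sym_involsP: fA => _ _ ->.
rewrite -sum1_card (partition_big (fun f : {ffun T -> T} => f x)
  (mem (A :\ x))) //=.
under eq_bigr => y yA do rewrite sum1dep_card.
have rxAx : r x \in A :\ x by rewrite !inE xr.
rewrite (bigD1 (r x)) //= cut // 1?eq_sym // eqxx.
have -> : \sum_(y in A :\ x | y != r x)
            #|[set f : {ffun T -> T} in sym_invols A | f x == y]|
        = \sum_(y in A :\ x :\ r x) sym_pairings k.-1.
  apply: eq_big => [y|y /andP[yAx yr]]; first by rewrite !inE andbC.
  move: yAx; rewrite !inE => /andP[yx yA].
  by rewrite cut ?(negPf yr) // eq_sym.
rewrite sum_nat_const.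
have := cardsD1 x A; have := cardsD1 (r x) (A :\ x).
rewrite rxAx xA cA => e1 e2; have -> : #|A :\ x :\ r x| = 2 * k by lia.
(* For k = 0 the predecessor is a default value, multiplied by 0. *)
case: k {IH cut cA e1 e2} => [|k]; last by rewrite sym_pairingsS mulnA.
by rewrite muln0 mul0n addn0 sym_pairings0 sym_pairings1.
Qed.

End Symmetric.

(** * Counting stable subsets and clan shapes *)

(** Here [r] has the single fixed point [c], and [L] contains exactly one point
    of each of its other orbits. *)
Section Reflection.
Variables (T : finType) (r : T -> T) (L : {set T}) (c : T).
Hypothesis rK : involutive r.
Hypothesis rL : forall x, x != c -> (r x \in L) = (x \notin L).
Hypothesis rc : forall x, (r x == x) = (x == c).
Hypothesis cL : c \notin L.
Implicit Types (A B S U P : {set T}).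

(** The union of the orbits that meet [U]: for [U] inside [L], the inverse of
    [S |-> S :&: L] on stable sets avoiding [c]. *)
Definition unfold_set U : {set T} := [set x | (x \in U) || (r x \in U)].

Lemma unfold_set_stable U : stable r (unfold_set U).
Proof. by apply/stableP => x; rewrite !inE rK orbC. Qed.

Lemma unfold_setK U : U \subset L -> unfold_set U :&: L = U.
Proof.
move/subsetP=> UL; apply/setP => x; rewrite !inE andbC.
have [xL|xL] /= := boolP (x \in L); last by apply/esym/negP => /UL; apply/negP.
have xc : x != c by apply: contraNneq cL => <-.
have [rxU|_] := boolP (r x \in U); last by rewrite orbF.
by have := UL _ rxU; rewrite rL // xL.
Qed.

Lemma unfold_setI S : stable r S -> c \notin S -> unfold_set (S :&: L) = S.
Proof.
move=> /stableP sS cS; apply/setP => x; rewrite !inE sS -andb_orr.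
have [xS /=|//] := boolP (x \in S).
by rewrite rL ?orbN //; apply: contraNneq cS => <-.
Qed.

Lemma card_unfold_set U : U \subset L -> #|unfold_set U| = 2 * #|U|.
Proof.
move/subsetP=> UL.
have img x : (x \in r @: U) = (r x \in U).
  by rewrite -{1}(rK x) (mem_imset _ _ (inv_inj rK)).
have -> : unfold_set U = U :|: r @: U.
  by apply/setP => x; rewrite in_setU img inE.
rewrite cardsU card_imset; last exact: inv_inj.
suff -> : U :&: r @: U = set0 by rewrite cards0 subn0 mul2n addnn.
apply/setP => x; rewrite in_setI img inE.
apply/negP => /andP[xU rxU]; have := UL _ rxU.
by rewrite rL ?UL //; apply: contraNneq cL => <-; exact: UL.
Qed.

Lemma card_stable S : stable r S -> c \notin S -> #|S| = 2 * #|S :&: L|.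
Proof. by move=> sS cS; rewrite -card_unfold_set ?unfold_setI ?subsetIr. Qed.

Lemma stableD1 S : stable r S -> stable r (S :\ c).
Proof.
move=> /stableP sS; apply/stableP => x; rewrite !inE sS.
have /eqP rcc : r c == c by rewrite rc.
by rewrite -{1}rcc (inj_eq (inv_inj rK)).
Qed.

Lemma odd_card_stable S : stable r S -> odd #|S| = (c \in S).
Proof.
move=> sS; rewrite (cardsD1 c) (card_stable (stableD1 sS)) ?setD11 //.
by rewrite mul2n oddD odd_double addbF oddb.
Qed.

Lemma card_stable_subsets_free B j : stable r B -> c \notin B ->
  #|[set S : {set T} | [&& S \subset B, stable r S & #|S| == 2 * j]]|
  = 'C(#|B|./2, j).
Proof.
move=> sB cB.
rewrite (card_stable sB cB) [X in X./2]mul2n doubleK -cards_draws.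
rewrite -[RHS](@card_in_imset _ _ unfold_set); last first.
  move=> U V; rewrite !inE !subsetI => /andP[/andP[_ UL] _] /andP[/andP[_ VL] _] e.
  by rewrite -(unfold_setK UL) e unfold_setK.
apply: eq_card => S; rewrite !inE; apply/and3P/imsetP => [[SB sS /eqP cS]|[U]].
  have cnS : c \notin S by apply: contraNN cB; apply: (subsetP SB).
  exists (S :&: L); last by rewrite unfold_setI.
  by rewrite inE setSI //= -(eqn_pmul2l (isT : 0 < 2)) -card_stable ?cS.
rewrite inE subsetI => /andP[/andP[/subsetP UB UL] /eqP cU] ->; split.
- apply/subsetP => x; rewrite inE => /orP[/UB//|/UB].
  by rewrite (stableP _ _ sB).
- exact: unfold_set_stable.
- by rewrite card_unfold_set // cU.
Qed.

(** By parity, [b] tells whether [S] contains [c]; removing [c] from [S] reduces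
    to the stable subsets of [B :\ c].  As [#|B|] is odd, halving it rounds down
    to the number of two-element orbits in [B]. *)
Lemma card_stable_subsets B j (b : bool) : stable r B -> c \in B ->
  #|[set S : {set T} | [&& S \subset B, stable r S & #|S| == 2 * j + b]]|
  = 'C(#|B|./2, j).
Proof.
move=> sB cB.
have -> : #|B|./2 = #|B :\ c|./2.
  rewrite (cardsD1 c B) cB (card_stable (stableD1 sB)) ?setD11 //; lia.
rewrite -card_stable_subsets_free ?setD11 ?stableD1 //.
pose add S := if b then c |: S else S.
rewrite -[RHS](@card_in_imset _ _ add); last first.
  rewrite /add => S S'; rewrite !inE !subsetD1.
  move=> /andP[/andP[_ cS] _] /andP[/andP[_ cS'] _].
  by case: (b) => // e; rewrite -(setU1K cS) e setU1K.
have parity S : stable r S -> #|S| == 2 * j + b -> (c \in S) = b.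
  move=> sS /eqP cS; rewrite -odd_card_stable // cS.
  by rewrite mul2n oddD odd_double oddb.
apply: eq_card => S; rewrite !inE; apply/and3P/imsetP => [[SB sS cS]|[S']].
  have cSb := parity S sS cS.
  exists (S :\ c); last first.
    rewrite /add; move: cSb; case: (b) => cSb; first by rewrite setD1K.
    by apply/setP => x; rewrite !inE; case: eqP => // ->.
  rewrite inE setSD // stableD1 //=.
  by move: cS; rewrite (cardsD1 c S) cSb addnC eqn_add2r.
rewrite inE subsetD1 => /and3P[/andP[S'B cS'] sS' cS'j] ->; rewrite /add.
case: (b) => /=; last by rewrite addn0.
split; [by rewrite subUset sub1set cB S'B| |].
  have /eqP rcc : r c == c by rewrite rc.
  apply/stableP => x; rewrite !inE (stableP _ _ sS').
  by rewrite -{1}rcc (inj_eq (inv_inj rK)).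
by rewrite cardsU1 cS' addnC eqn_add2r.
Qed.

Lemma center_unmoved f A : f \in sym_invols r A -> c \notin A.
Proof.
move=> /sym_involsP[_ fr fA].
have /eqP rcc : r c == c by rewrite rc.
by rewrite -fA negbK -rc -fr rcc.
Qed.

(** The images of the symmetric clans with [k] pairs: once [f] moves [2k] points
    of [s + t], the last condition says that the plus points outnumber the
    remaining unmoved points by [s - t]. *)
Definition clan_shapes (k s : nat) : {set {ffun T -> T} * {set T}} :=
  [set fP : {ffun T -> T} * {set T} |
    [&& fP.1 \in sym_invols r (moved fP.1), #|moved fP.1| == 2 * k,
        fP.2 \subset ~: moved fP.1, stable r fP.2 & #|fP.2| + k == s]].

(** Sorting by the set of moved points: there is one such set for each choice of
    [k] among the two-element orbits. *)
Lemma card_sym_invols_moved k :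
  #|[set f : {ffun T -> T} | (f \in sym_invols r (moved f)) &&
                             (#|moved f| == 2 * k)]|
  = 'C(#|T|./2, k) * sym_pairings k.
Proof.
have cD1 : #|[set: T] :\ c|./2 = #|T|./2.
  have s1 : stable r ([set: T] :\ c).
    by apply: stableD1; apply/stableP => x; rewrite !inE.
  rewrite -cardsT (cardsD1 c setT) inE (card_stable s1) ?setD11 //; lia.
rewrite -cD1 -card_stable_subsets_free ?setD11 //; last first.
  by apply: stableD1; apply/stableP => x; rewrite !inE.
rewrite -sum1_card (partition_big (@moved T)
  (mem [set A : {set T} | [&& A \subset setT :\ c, stable r A & #|A| == 2 * k]]));
  last first.
  move=> f; rewrite inE => /andP[fA cf]; rewrite !inE cf andbT.
  rewrite subsetD1 subsetT (center_unmoved fA).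
  exact: (sym_invols_stable rK fA).
rewrite -sum_nat_const; apply: eq_bigr => A.
rewrite !inE => /and3P[Ac sA /eqP cA].
rewrite sum1dep_card -(card_sym_invols rK sA _ cA); last first.
  by move=> x /(subsetP Ac); rewrite !inE andbT rc.
apply: eq_card => f; rewrite [LHS]inE.
apply/idP/idP => [/andP[]|fA].
  by rewrite inE => /andP[fA _] /eqP <-.
have mf : moved f = A by apply/setP => x; rewrite inE; case/sym_involsP: fA.
by rewrite inE mf fA cA !eqxx.
Qed.

(** The number of admissible [P] depends on [f] only through the number of
    points that [f] moves, hence the product. *)
Lemma card_clan_shapes k s j (b : bool) : s = k + (2 * j + b) ->
  #|clan_shapes k s|
  = 'C((#|T| - 2 * k)./2, j) * ('C(#|T|./2, k) * sym_pairings k).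
Proof.
move=> sE; rewrite -card_sym_invols_moved.
rewrite -sum1_card; under eq_bigl => fP do rewrite inE andbA.
rewrite -(pair_big_dep (fun f : {ffun T -> T} => (f \in sym_invols r (moved f)) &&
                             (#|moved f| == 2 * k))
  (fun f P => [&& P \subset ~: moved f, stable r P & #|P| + k == s])
  (fun _ _ => 1)) /=.
rewrite [RHS]mulnC -sum_nat_const; apply: eq_big => [f|f]; first by rewrite inE.
case/andP=> fA /eqP cA; rewrite sum1dep_card.
have := cardsC (moved f); rewrite cA => cC.
rewrite -[X in (X - _)./2]cC addKn.
rewrite -(@card_stable_subsets _ j b); last first.
- by rewrite inE (center_unmoved fA).
- exact/stableC/(sym_invols_stable rK fA).
apply: eq_card => P; rewrite !inE; congr [&& _, _ & _].
by rewrite sE addnC eqn_add2l.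
Qed.

End Reflection.

(** * Clans as pairs of an involution and a set *)

Section Strings.
Variable m : nat.
Implicit Types (c d : m.-tuple symbol) (i j : 'I_m).

(** The part of the preclan condition that makes matching an involution; unlike
    the sign condition, it makes sense for strings without [s] and [t]. *)
Definition paired c : bool :=
  all (fun x => is_number x ==> (count_mem x c == 2)) c.

Definition plus_set c : {set 'I_m} := [set i | tnth c i == Plus].

Definition mate c : {ffun 'I_m -> 'I_m} :=
  [ffun i => odflt i [pick j | (j != i) && matched c i j]].

Lemma count_tuple (a : pred symbol) c : count a c = #|[set i | a (tnth c i)]|.
Proof. by rewrite -sum1_count big_tuple sum1dep_card. Qed.

Lemma pairedP c :
  reflect (forall i, is_number (tnth c i) ->
                     #|[set j | tnth c i == tnth c j]| = 2) (paired c).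
Proof.
have cE i : count_mem (tnth c i) c = #|[set j | tnth c i == tnth c j]|.
  by rewrite count_tuple; apply: eq_card => j; rewrite !inE eq_sym.
apply: (iffP allP) => [h i ni|h x /tnthP[i ->]].
  by rewrite -cE; apply/eqP/(implyP (h _ (mem_tnth i c))).
by apply/implyP => ni; rewrite cE h.
Qed.

(** A number occurs twice, so the set of its positions minus [i] is a
    singleton. *)
Lemma mate_number c i : paired c -> (mate c i != i) = is_number (tnth c i).
Proof.
move=> /pairedP pc; rewrite ffunE; case: pickP => [j /andP[ji]|no] /=.
  by rewrite ji /matched => /andP[->].
rewrite eqxx; apply/esym/negP => ni.
have : i \in [set j | tnth c i == tnth c j] by rewrite inE.
have := pc i ni; rewrite (cardsD1 i) inE eqxx => -[/eqP/cards1P[j e]] _.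
have : j \in [set j | tnth c i == tnth c j] :\ i by rewrite e set11.
by rewrite !inE => /andP[ji cij]; have := no j; rewrite ji /matched ni cij.
Qed.

Lemma matchedE c i j : paired c ->
  matched c i j = is_number (tnth c i) && ((j == i) || (j == mate c i)).
Proof.
move=> pc; rewrite /matched.
have [ni|//] /= := boolP (is_number _).
have mi : mate c i != i by rewrite mate_number.
have cm : tnth c i == tnth c (mate c i).
  move: mi; rewrite ffunE; case: pickP => /= [k /andP[_ /andP[]]//|_].
  by rewrite eqxx.
have : [set i; mate c i] == [set k | tnth c i == tnth c k].
  rewrite eqEcard cards2 eq_sym mi (pairedP _ pc) // andbT.
  by apply/subsetP => k; rewrite !inE => /orP[] /eqP->.
by move/eqP/setP/(_ j); rewrite !inE => <-.
Qed.

Lemma mate_uniq c i j : paired c -> j != i -> matched c i j -> mate c i = j.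
Proof.
move=> pc ji; rewrite matchedE // (negPf ji) /= => /andP[_].
by rewrite eq_sym => /eqP.
Qed.

Lemma mate_id c i : paired c -> ~~ is_number (tnth c i) -> mate c i = i.
Proof. by move=> pc; rewrite -mate_number // negbK => /eqP. Qed.

Lemma mateK c : paired c -> involutive (mate c).
Proof.
move=> pc i; have [ni|ni] := boolP (is_number (tnth c i)); last first.
  by rewrite !mate_id // mate_id.
have mi : mate c i != i by rewrite mate_number.
have : matched c i (mate c i) by rewrite matchedE // ni eqxx orbT.
case/andP => _ /eqP e; apply: mate_uniq => //; first by rewrite eq_sym.
by rewrite /matched -e eqxx ni.
Qed.

(** The matching determines which positions carry numbers, and what is neither
    a number nor a plus is a minus. *)
Lemma equiv_shape c d : paired c -> paired d ->
  equiv_strings c d = (mate c == mate d) && (plus_set c == plus_set d).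
Proof.
move=> pc pd; apply/equiv_stringsP/andP => [[hs hm]|[/eqP em /eqP ep]].
  split; apply/eqP; last first.
    by apply/setP => i; rewrite !inE; case/andP: (hs i) => /eqP.
  apply/ffunP => i; rewrite !ffunE; congr odflt.
  by apply: eq_pick => j /=; rewrite hm.
have en i : is_number (tnth c i) = is_number (tnth d i).
  by rewrite -!mate_number // em.
split=> [i|i j]; last by rewrite !matchedE // en em.
have := en i; move/setP/(_ i): ep; rewrite !inE /same_sign.
by case: (tnth c i); case: (tnth d i).
Qed.

Lemma tnth_rev c i : tnth [tuple of rev c] i = tnth c (rev_ord i).
Proof. by rewrite (tnth_nth Plus) [RHS](tnth_nth Plus) /= nth_rev size_tuple. Qed.

Lemma rev_paired c : paired c -> paired [tuple of rev c].
Proof.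
move=> /allP pc; apply/allP => x; rewrite mem_rev => /pc.
by rewrite [X in count_mem x X]/= count_rev.
Qed.

Lemma matched_rev c i j :
  matched [tuple of rev c] i j = matched c (rev_ord i) (rev_ord j).
Proof. by rewrite /matched !tnth_rev. Qed.

Lemma mate_rev c i : paired c ->
  mate [tuple of rev c] i = rev_ord (mate c (rev_ord i)).
Proof.
move=> pc; have pr := rev_paired pc.
have [ni|ni] := boolP (is_number (tnth c (rev_ord i))); last first.
  by rewrite !mate_id ?rev_ordK // tnth_rev.
have mi : mate c (rev_ord i) != rev_ord i by rewrite mate_number.
apply: mate_uniq => //; first by rewrite (inv_eq (@rev_ordK m)).
by rewrite matched_rev rev_ordK matchedE // ni eqxx orbT.
Qed.

Lemma symmetric_stringE c : paired c ->
  symmetric_string c =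
  (mate c \in sym_invols (@rev_ord m) (moved (mate c))) &&
  stable (@rev_ord m) (plus_set c).
Proof.
move=> pc; rewrite /symmetric_string equiv_shape ?rev_paired //.
congr (_ && _).
  apply/eqP/sym_involsP => [e|[_ fr _]].
    split=> [i|i|i]; first exact: mateK; last by rewrite inE.
    by rewrite {1}e mate_rev // rev_ordK.
  by apply/ffunP => i; rewrite mate_rev // fr rev_ordK.
apply/eqP/stableP => [e i|e]; first by rewrite {1}e !inE tnth_rev rev_ordK.
by apply/setP => i; rewrite -e !inE tnth_rev.
Qed.

(** A canonical preclan with a given matching: each pair is labelled by its
    smaller position. *)
Definition string_of (f : {ffun 'I_m -> 'I_m}) (P : {set 'I_m}) :
    m.-tuple symbol :=
  [tuple if f i != i then Number (minn i (f i))
         else if i \in P then Plus else Minus | i < m].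

Lemma string_ofP (f : {ffun 'I_m -> 'I_m}) (P : {set 'I_m}) :
    involutive f -> P \subset ~: moved f ->
  [/\ paired (string_of f P), mate (string_of f P) = f
    & plus_set (string_of f P) = P].
Proof.
move=> fK /subsetP Pf; set c := string_of f P.
have nE i : is_number (tnth c i) = (f i != i).
  by rewrite tnth_mktuple; case: ifP => // _; case: ifP.
have cE i j : f i != i -> (tnth c i == tnth c j) = (j == i) || (j == f i).
  move=> fi; rewrite !tnth_mktuple fi.
  have [fj|fj] := eqVneq (f j) j.
    transitivity false; first by case: ifP.
    apply/esym/negP => /orP[] /eqP ji; move: fj fi; rewrite ji.
      by move=> ->; rewrite eqxx.
    by rewrite fK => <-; rewrite eqxx.
  apply/eqP/orP => [[e]|[]/eqP ->] //; last by rewrite fK minnC.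
  (* Equal minima force the two pairs to share a point. *)
  have : (j == i) || (j == f i) || (f j == i) || (f j == f i).
    by rewrite -!(inj_eq val_inj) /=; lia.
  rewrite (inj_eq (inv_inj fK)) (inv_eq fK).
  by case: (j == i); case: (j == f i); rewrite ?orbT //; auto.
have pc : paired c.
  apply/pairedP => i; rewrite nE => fi.
  rewrite -[RHS](_ : #|[set i; f i]| = 2); last by rewrite cards2 eq_sym fi.
  by apply: eq_card => j; rewrite !inE cE.
split=> //.
  apply/ffunP => i; have [fi|fi] := eqVneq (f i) i.
    by rewrite mate_id // nE fi eqxx.
  by apply: mate_uniq => //; rewrite /matched nE fi cE // eqxx orbT.
apply/setP => i; rewrite inE tnth_mktuple.
have [fi|fi] := eqVneq (f i) i; first by case: ifP.
by apply/esym/negP => /Pf; rewrite !inE fi.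
Qed.

End Strings.

(** Adding the numbers of plus, minus and numbered positions gives [s + t];
    eliminating the number of minus signs yields the condition on plus signs. *)
Lemma is_preclanE s t (c : (s + t).-tuple symbol) k :
  paired c -> #|moved (mate c)| = 2 * k ->
  is_preclan c = (#|plus_set c| + k == s).
Proof.
move=> pc ck; rewrite /is_preclan [X in _ && X](_ : _ = true) // andbT.
have cP : count_mem Plus c = #|plus_set c| by rewrite count_tuple.
have cN : count is_number c = 2 * k.
  by rewrite -ck count_tuple; apply: eq_card => i; rewrite !inE mate_number.
have : count_mem Plus c + count_mem Minus c + count is_number c = s + t.
  rewrite -[RHS](size_tuple c); elim: (tval c) => //= -[||v] l <- /=; lia.
by rewrite cN cP => e; apply/eqP/eqP; lia.
Qed.

Lemma preclan_paired s t (c : preclan s t) : paired c.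
Proof. by case/andP: (preclanP c). Qed.

Definition shape s t (g : clan s t) :
    {ffun 'I_(s + t) -> 'I_(s + t)} * {set 'I_(s + t)} :=
  (mate (repr g), plus_set (repr g)).

Lemma shape_inj s t : injective (@shape s t).
Proof.
move=> g h [em ep]; rewrite -(clan_of_repr g) -(clan_of_repr h).
apply/clan_ofP; rewrite /preclan_equiv equiv_shape ?preclan_paired //.
by rewrite em ep !eqxx.
Qed.

Lemma shape_clan_of s t (c : preclan s t) :
  shape (clan_of c) = (mate c, plus_set c).
Proof.
have := repr_clan_of c; rewrite /preclan_equiv equiv_shape ?preclan_paired //.
by rewrite /shape => /andP[/eqP-> /eqP->].
Qed.

Lemma card_moved_mate s t (c : preclan s t) :
  #|moved (mate c)| = 2 * npairs_string c.
Proof.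
rewrite mulnC -count_number_preclan count_tuple.
by apply: eq_card => i; rewrite !inE mate_number ?preclan_paired.
Qed.

Lemma card_symmetric_clans s t k :
  #|[set g : clan s t | symmetric_clan g & npairs g == k]|
  = #|clan_shapes (@rev_ord (s + t)) k s|.
Proof.
rewrite -(card_imset _ (@shape_inj s t)); apply: eq_card => -[f P].
apply/imsetP/idP => [[g]|].
  rewrite inE => /andP[sg /eqP kg] e; rewrite inE e /=.
  have pc := preclan_paired (repr g).
  have ck := card_moved_mate (repr g); rewrite -/(npairs g) kg in ck.
  have := preclanP (repr g); rewrite (is_preclanE pc ck) => ->.
  move: sg; rewrite /symmetric_clan symmetric_stringE // => /andP[-> ->].
  rewrite ck eqxx /= andbT; apply/subsetP => i.
  by rewrite !inE mate_number // => /eqP->.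
rewrite inE => /and5P[/= fA /eqP ck Pf sP PK].
have fK : involutive f by case/sym_involsP: fA.
have [pc mc Pc] := string_ofP fK Pf.
have cc : is_preclan (string_of f P).
  by rewrite (is_preclanE (k := k)) ?mc // Pc.
exists (clan_of (Preclan cc)); last by rewrite shape_clan_of /= mc Pc.
rewrite inE symmetric_clan_of npairs_clan_of symmetric_stringE //= mc Pc fA sP.
have := card_moved_mate (Preclan cc); rewrite /= mc ck.
by move/eqP; rewrite eqn_pmul2l // eq_sym.
Qed.

(** Halves are taken of [2n + 1] positions, and of the [2n + 1 - 2k] unmoved
    ones, with [n = p + q]. *)
Lemma card_symmetric_shapes p q k j (b : bool) : 2 * p = k + (2 * j + b) ->
  #|clan_shapes (@rev_ord (2 * p + (2 * q + 1))) k (2 * p)|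
  = 'C(p + q - k, j) * 'C(p + q, k) * sym_pairings k.
Proof.
move=> pE; have cN : p + q < 2 * p + (2 * q + 1) by lia.
rewrite (@card_clan_shapes _ _ [set i : 'I__ | i < p + q] (Ordinal cN) _ _ _ _
  k (2 * p) j b) //; last first.
- by rewrite inE ltnn.
- by move=> x; rewrite -!(inj_eq val_inj) /=; have := ltn_ord x; lia.
- move=> x; rewrite !inE -!(inj_eq val_inj) /=.
  by have := ltn_ord x; lia.
- exact: rev_ordK.
by rewrite card_ord mulnA; congr ('C(_, _) * 'C(_, _) * _); lia.
Qed.

Lemma beta_even p q l : l <= p ->
  beta (2 * l) p q
  = 'C(p + q - 2 * l, p - l) * 'C(p + q, 2 * l) * a_even l.
Proof.
move=> lp; rewrite /beta card_symmetric_clans a_evenE.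
by apply: (@card_symmetric_shapes _ _ _ _ false); lia.
Qed.

Lemma beta_odd p q l : l < p ->
  beta (2 * l + 1) p q
  = 'C(p + q - (2 * l + 1), p - (l + 1)) * 'C(p + q, 2 * l + 1) * a_odd l.
Proof.
move=> lp; rewrite /beta card_symmetric_clans a_oddE.
by apply: (@card_symmetric_shapes _ _ _ _ true); lia.
Qed.

(** The [2p - k] plus signs and the [2k] matched positions are disjoint among
    [2p + 2q + 1] positions. *)
Lemma npairs_bound p q (g : clan (2 * p) (2 * q + 1)) : npairs g <= 2 * q + 1.
Proof.
have ck := card_moved_mate (repr g).
have := preclanP (repr g); rewrite (is_preclanE (preclan_paired _) ck) => /eqP e.
have := subset_leq_card (subsetT (plus_set (repr g) :|: moved (mate (repr g)))).
rewrite cardsT card_ord cardsU disjoint_setI0 ?cards0; last first.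
  rewrite -setI_eq0; apply/eqP/setP => i.
  rewrite !inE mate_number ?preclan_paired //.
  by case: (tnth _ i).
by rewrite ck /npairs; lia.
Qed.

Lemma nsymmetric_clans_sum p q :
  nsymmetric_clans p q =
  \sum_(0 <= l < q.+1) (beta (2 * l) p q + beta (2 * l + 1) p q).
Proof.
have -> : nsymmetric_clans p q = \sum_(0 <= k < 2 * q.+1) beta k p q.
  rewrite big_mkord /nsymmetric_clans -sum1_card.
  have lt_np (g : clan (2 * p) (2 * q + 1)) : npairs g < 2 * q.+1.
    by have := npairs_bound g; lia.
  rewrite (partition_big (fun g => Ordinal (lt_np g)) xpredT) //=.
  apply: eq_bigr => k _; rewrite /beta -[RHS]sum1_card.
  by apply: eq_bigl => g; rewrite !inE.
elim: q.+1 => [|n IH]; first by rewrite !big_geq.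
by rewrite [RHS]big_nat_recr //= -IH mulnS !big_nat_recr //= addn1 addnA.
Qed.

Theorem theorem1p2 (p q : nat) (hpq : q < p) :
  let n := p + q in
  (forall k : nat, k <= 2 * q + 1 ->
     (forall l : nat, k = 2 * l ->
        beta k p q = 'C(n - 2 * l, p - l) * 'C(n, 2 * l) * a_even l) /\
     (forall l : nat, k = 2 * l + 1 ->
        beta k p q =
          'C(n - (2 * l + 1), p - (l + 1)) * 'C(n, 2 * l + 1) * a_odd l)) /\
  nsymmetric_clans p q =
    \sum_(0 <= l < q.+1)
      ('C(n - 2 * l, p - l) * 'C(n, 2 * l) * a_even l +
       'C(n - (2 * l + 1), p - (l + 1)) * 'C(n, 2 * l + 1) * a_odd l).
Proof.
move=> n; split=> [k kq|].
  by split=> l kl; rewrite kl ?beta_even ?beta_odd //; lia.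
rewrite nsymmetric_clans_sum !big_mkord; apply: eq_bigr => l _.
have := ltn_ord l => lq.
by rewrite beta_even ?beta_odd //; lia.
Qed.
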